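(* Let $\dot x = Ax+g(x)$ on $\mathbb{R}^n$, let $\mathcal{M}$ be a $d$-dimensional invariant manifold through the origin tangent there to eigenvectors $e_1,\dots,e_d$ of $A$ with eigenvalues $\lambda_1,\dots,\lambda_d$, and let $\mu:\mathbb{R}^n\to\mathbb{R}$ be a differentiable scalar observable with delay-embedding (sampling) map $S:\mathbb{R}^n\to\mathbb{R}^p$ of timelag $\tau>0$, embedding $\mathcal{M}$ onto $\tilde{\mathcal{M}}=S(\mathcal{M})\subset\mathbb{R}^p$ (all as specified in the context). Assume that $\mu$ is generic, in the sense that $\left.\frac{\partial\mu}{\partial z_k}\right|_{0}\neq 0$ for all $k\in\{1,\dots,d\}$, and that $\lambda_1,\dots,\lambda_d$ are pairwise distinct. Then the tangent space of $\tilde{\mathcal{M}}$ at the fixed point $y_0=S(0)$ is $$T_{y_0}\tilde{\mathcal{M}}=\operatorname{range} V,$$ where $V\in\mathbb{C}^{p\times d}$ is the Vandermonde matrix whose $k$-th column is $(1,\mathrm{e}^{\lambda_k\tau},\mathrm{e}^{2\lambda_k\tau},\dots,\mathrm{e}^{(p-1)\lambda_k\tau})^{\top}$.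
   Context: System: $\dot x = Ax+g(x)$, $x\in\mathbb{R}^n$, of class $\mathcal{C}^l$ with $l\in\mathbb{N}^+\cup\{\infty,a\}$ ($a$ = analytic), $g:\mathbb{R}^n\to\mathbb{R}^n$, $g(x)=\mathcal{O}(|x|^2)$, and $A\in\mathbb{R}^{n\times n}$ diagonalizable (over $\mathbb{C}$) with eigenvalues $\lambda_1,\dots,\lambda_n$ and eigenvectors $e_1,\dots,e_n$; $E=[e_1,\dots,e_n]$. The flow map is $F^t(x_0)=x(t,x_0)$, assumed defined for the times used. Modal coordinates: $z=E^{-1}x\in\mathbb{C}^n$. The observable is viewed as a function of $z$ through $\mu(x)=\mu(Ez)$, so $\left.\frac{\partial\mu}{\partial z_k}\right|_{0}=D\mu(0)e_k$, with $D\mu(0)$ extended complex-linearly. Invariant manifold: $\mathcal{M}\subset\mathbb{R}^n$ is a $d$-dimensional invariant manifold of the flow containing $0$, with $T_0\mathcal{M}=\operatorname{span}\{e_1,\dots,e_d\}$. Delay embedding: $S:\mathbb{R}^n\to\mathbb{R}^p$, $S(x)=\big(\mu(x),\mu(F^{\tau}(x)),\mu(F^{2\tau}(x)),\dots,\mu(F^{(p-1)\tau}(x))\big)^{\top}$. The conditions of Takens's embedding theorem are assumed to hold, in the sense that $S|_{\mathcal{M}}:\mathcal{M}\to\tilde{\mathcal{M}}:=S(\mathcal{M})$ is a smooth (at least $C^1$) embedding with smooth inverse. The fixed point in the observable space is $y_0=S(0)=(\mu(0),\dots,\mu(0))^\top$. Convention: tangent spaces are spanned by possibly complex eigenvectors,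 so equalities of tangent spaces with complex spans or ranges are understood after complexification (i.e. $T_0\mathcal{M}\otimes\mathbb{C}$ is the complex span of $e_1,\dots,e_d$, and $T_{y_0}\tilde{\mathcal{M}}\otimes\mathbb{C}=\operatorname{range}V$ in $\mathbb{C}^p$). *)

(* Defs.v *)
(* MathComp-Analysis: [R : realType], with [R[i]] for the complex numbers. *)
From HB Require Import structures.
From mathcomp Require Import all_boot all_order all_algebra.
From mathcomp Require Import all_classical all_reals all_analysis.
From mathcomp Require Import complex.

Set Implicit Arguments.
Unset Strict Implicit.
Unset Printing Implicit Defensive.
Import Order.TTheory GRing.Theory Num.Theory.
Import numFieldNormedType.Exports.
Local Open Scope classical_set_scope.
Local Open Scope complex_scope.
Local Open Scope ring_scope.

Section Smoothness.
Context {R : realType} {V W : normedModType R}.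

(* In finite dimension, continuity of [x |-> 'd f x v] for every [v] is
   continuity of the differential. *)
Fixpoint Ck (k : nat) (U : set V) (f : V -> W) : Prop :=
  if k is k'.+1 then
    (forall x, U x -> differentiable f x) /\
    (forall v, Ck k' U (fun x => 'd f x v))
  else forall x, U x -> {for x, continuous f}.

(* The [k]-th term is [D^k f(x)[h, ..., h] / k!], that is, the homogeneous part
   of degree [k] of the multivariate Taylor series. *)
Definition taylor_term (f : V -> W) (x h : V) (k : nat) : W :=
  (k`!%:R : R)^-1 *: derive1n k (fun t : R => f (x + t *: h)) 0.

Definition analytic (f : V -> W) : Prop :=
  (forall k, Ck k setT f) /\
  forall x, exists2 r : R, 0 < r &
    forall h, `|h| < r -> series (taylor_term f x h) @ \oo --> f (x + h).

End Smoothness.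

Inductive smoothness : Type :=
  | Cfinite k of (0 < k)%N
  | Cinfinity
  | Canalytic.

Definition of_class {R : realType} {V W : normedModType R}
    (l : smoothness) (f : V -> W) : Prop :=
  match l with
  | Cfinite k _ => Ck k setT f
  | Cinfinity => forall k, Ck k setT f
  | Canalytic => analytic f
  end.

Section Dynamics.
Context {R : realType} {n : nat}.
Implicit Types (f : 'cV[R]_n -> 'cV[R]_n) (J : set R).

Definition is_trajectory f J (x : R -> 'cV[R]_n) : Prop :=
  [/\ is_interval J, open J, J 0 &
      forall t, J t -> is_derive t (1 : R) x (f (x t))].

(* Values [F t x] at times outside the existence interval are junk; only the
   existence of solutions on [0, T] is required. *)
Definition is_flow_upto f (T : R) (F : R -> 'cV[R]_n -> 'cV[R]_n) : Prop :=
  forall x, F 0 x = x /\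
    exists2 J, `[0, T]%classic `<=` J & is_trajectory f J (F ^~ x).

Definition flow_invariant f (M : set 'cV[R]_n) : Prop :=
  forall J x, is_trajectory f J x -> M (x 0) -> forall t, J t -> M (x t).

End Dynamics.

Section Submanifolds.
Context {R : realType}.

(* C^1 maps and diffeomorphisms between arbitrary subsets of R^m and R^n, by
   local C^1 extension to open sets of the ambient space (Milnor). *)
Definition C1_on {m n} (X : set 'cV[R]_m) (f : 'cV[R]_m -> 'cV[R]_n) : Prop :=
  forall x, X x -> exists U (f' : 'cV[R]_m -> 'cV[R]_n),
    [/\ open U, U x, Ck 1 U f' & forall y, X y -> U y -> f' y = f y].

Definition C1_diffeo {m n} (X : set 'cV[R]_m) (Y : set 'cV[R]_n)
    (f : 'cV[R]_m -> 'cV[R]_n) : Prop :=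
  [/\ set_bij X Y f, C1_on X f &
      exists h, (forall x, X x -> h (f x) = x) /\ C1_on Y h].

Definition submanifold {n} (d : nat) (M : set 'cV[R]_n) : Prop :=
  forall x, M x -> exists U (W : set 'cV[R]_d) phi,
    [/\ open U, U x, open W & C1_diffeo W (M `&` U) phi].

Definition embedding_on {m n} (M : set 'cV[R]_m) (S : 'cV[R]_m -> 'cV[R]_n) :=
  C1_diffeo M (S @` M) S.

Definition tangent_space {n} (M : set 'cV[R]_n) (x : 'cV[R]_n) : set 'cV[R]_n :=
  [set v | exists c : R -> 'cV[R]_n,
    [/\ c 0 = x, \forall t \near (0 : R), M (c t) /\ derivable c t 1 &
        is_derive (0 : R) (1 : R) c v]].

End Submanifolds.

Section Complexification.
Context {R : realType}.

Definition Re_mx {m n} (z : 'M[R[i]]_(m, n)) : 'M[R]_(m, n) :=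
  map_mx (@complex.Re R) z.

Definition Im_mx {m n} (z : 'M[R[i]]_(m, n)) : 'M[R]_(m, n) :=
  map_mx (@complex.Im R) z.

(* [T + iT], which is the tensor product of [T] with C when [T] is a real
   subspace of R^n. *)
Definition complexification {n} (T : set 'cV[R]_n) : set 'cV[R[i]]_n :=
  [set z | T (Re_mx z) /\ T (Im_mx z)].

Definition complex_span {n d} (e : 'I_d -> 'cV[R[i]]_n) : set 'cV[R[i]]_n :=
  [set z | exists c : 'I_d -> R[i], z = \sum_(k < d) c k *: e k].

Definition cexp (z : R[i]) : R[i] :=
  (expR (complex.Re z))%:C * (cos (complex.Im z) +i* sin (complex.Im z)).

(* Complex-linear extension of the differential. *)
Definition diffC {n} (mu : 'cV[R]_n -> R) (x : 'cV[R]_n) (v : 'cV[R[i]]_n) :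
    R[i] :=
  ('d mu x (Re_mx v)) +i* ('d mu x (Im_mx v)).

(* The partial derivative of [mu] with respect to the [k]-th coordinate of
   [z = E^-1 x], at [z = 0]. *)
Definition modal_derivative {n} (E : 'M[R[i]]_n) (mu : 'cV[R]_n -> R)
    (k : 'I_n) : R[i] :=
  diffC mu 0 (col k E).

Definition delay_map {n} (F : R -> 'cV[R]_n -> 'cV[R]_n) (mu : 'cV[R]_n -> R)
    (tau : R) (p : nat) (x : 'cV[R]_n) : 'cV[R]_p :=
  \col_(j < p) mu (F (j%:R * tau) x).

Definition delay_vandermonde {d} (lambda : 'I_d -> R[i]) (tau : R) (p : nat) :
    'M[R[i]]_(p, d) :=
  \matrix_(j < p, k < d) cexp (j%:R * lambda k * tau%:C).

End Complexification.

(* Main.v *)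
Require Import Defs.
From HB Require Import structures.
From mathcomp Require Import all_boot all_order all_algebra.
From mathcomp Require Import all_classical all_reals all_analysis.
From mathcomp Require Import complex ring lra.

Set Implicit Arguments.
Unset Strict Implicit.
Unset Printing Implicit Defensive.
Import Order.TTheory GRing.Theory Num.Theory.
Import numFieldNormedType.Exports.
Local Open Scope classical_set_scope.
Local Open Scope complex_scope.
Local Open Scope ring_scope.

(** Let [T] be the tangent space of [M] at [0] and [S'] a local extension of the
    delay map [S]. Since [S] restricts to a C^1 diffeomorphism of [M] onto its
    image, the tangent space of the image at [S 0] is ['d S' 0 @` T]
    (Lemma [tangent_space_diffeo]); it remains to compute ['d S' 0] on [T].

    The origin is an equilibrium, and there the derivative of the time-[t] flow
    is the time-[t] flow of the linear equation [x' = A x]. This is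
    Lemma [is_derive_flow]; it follows from two applications of Gronwall's
    inequality to Euclidean norms (Lemma [linearization_estimate]). Hence, if
    [xi] solves the linear equation and [xi 0] is in [T], then
    ['d S' 0 (xi 0)] has the coordinates ['d mu 0 (xi (j%:R * tau))]
    (Lemma [diff_delay_map]).

    The complexification of [T] is spanned by the eigenvectors [e_1, ..., e_d].
    For a vector [w = \sum_k c_k e_k] of this span the linear solution is
    [\sum_k c_k exp (lambda_k t) e_k], so that the complexified differential of
    [S] maps [w] to the vector with [j]-th coordinate
    [\sum_k exp (j lambda_k tau) c_k m_k], where [m_k] is the derivative of [mu]
    along [e_k]. This vector is [V *m (c_k m_k)_k]. As no [m_k] vanishes,
    the vectors [(c_k m_k)_k] exhaust C^d, and the image of the complexification
    of [T] is the range of [V]. *)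

(** * Gronwall inequalities *)

(** The function [expR (- a * s) * u s - b * s] is nonincreasing: its derivative
    is at most [(expR (- a * s) - 1) * b]. *)
Lemma gronwall (R : realType) (u du : R -> R) (a b T : R) :
  0 <= a -> 0 <= b ->
  (forall t, 0 <= t <= T -> is_derive t (1 : R) u (du t)) ->
  (forall t, 0 < t < T -> du t <= a * u t + b) ->
  forall t, 0 <= t <= T -> u t <= expR (a * t) * (u 0 + b * t).
Proof.
move=> a0 b0 udu duu t /andP[t0 tT].
pose w s := expR (- a * s) * u s - b * s.
pose dw s := expR (- a * s) * (du s - a * u s) - b.
have wdw s : 0 <= s <= T -> is_derive s (1 : R) w (dw s).
  move=> /udu us.
  have -> : w = (expR \o (- a \*: id)) * u - b \*: id.
    by apply/funext => r; rewrite !fctE /= /GRing.scale.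
  by apply: is_derive_eq; rewrite /= /dw /GRing.scale/=; ring.
have dwle s : 0 < s < T -> dw s <= 0.
  move=> sT; rewrite /dw subr_le0.
  have ds : du s - a * u s <= b by rewrite lerBlDl duu.
  apply: (@le_trans _ _ (expR (- a * s) * b)).
    by rewrite ler_wpM2l// expR_ge0.
  rewrite -[leRHS]mul1r ler_wpM2r// -expR0 ler_expR.
  by case/andP: sT => s0 _; rewrite mulNr oppr_le0 mulr_ge0// ltW.
have : w t <= w 0.
  apply: (@ler0_derive1_nincr _ w 0 T) => //.
  - move=> s; rewrite in_itv/= => /andP[/ltW s0 /ltW sT].
    by have [] := wdw s; rewrite ?s0.
  - move=> s; rewrite in_itv/= => /[dup] sT /dwle.
    have [] := wdw s; first by case/andP : sT => /ltW -> /ltW.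
    by rewrite derive1E => _ ->.
  - apply: derivable_within_continuous => s; rewrite in_itv/= => sT.
    by have [] := wdw s.
rewrite /w !mulr0 expR0 mul1r subr0 lerBlDr mulNr expRN.
by rewrite ler_pdivrMl ?expR_gt0// mulrC.
Qed.

(** The differential inequality is known only where [u < eta], but the bound
    that it yields stays below [eta], so that [u] cannot be the first to leave
    this region. This is what turns an estimate of the vector field near the
    equilibrium into an a priori bound for nearby trajectories. *)
Lemma gronwall_local (R : realType) (u du : R -> R) (a eta T : R) :
  0 <= a ->
  (forall t, 0 <= t <= T -> is_derive t (1 : R) u (du t)) ->
  (forall t, 0 <= t <= T -> 0 <= u t) ->
  (forall t, 0 <= t <= T -> u t < eta -> du t <= a * u t) ->
  expR (a * T) * u 0 < eta ->
  forall t, 0 <= t <= T -> u t <= expR (a * T) * u 0.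
Proof.
move=> a0 udu u_ge0 duu u0eta.
have until m : 0 <= m <= T -> (forall s, 0 < s < m -> u s < eta) ->
    u m <= expR (a * T) * u 0.
  move=> /andP[m0 mT] small.
  have u00 : 0 <= u 0 by rewrite u_ge0// lexx (le_trans m0).
  apply: (@le_trans _ _ (expR (a * m) * (u 0 + 0 * m))).
    apply: (@gronwall _ u du a 0 m) => //; last by rewrite m0 lexx.
    - by move=> s /andP[s0 sm]; apply: udu; rewrite s0 (le_trans sm).
    - move=> s /[dup] /small us /andP[s0 sm]; rewrite addr0 duu//.
      by rewrite (ltW s0) (le_trans (ltW sm)).
  by rewrite mul0r addr0 ler_wpM2r// ler_expR ler_wpM2l.
(* There is no first time at which [u] reaches [eta]: just before it the bound
   [until] holds, and it is strict at that time by continuity. *)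
suff small s : 0 <= s <= T -> u s < eta.
  move=> t tT; apply: until => // s; case/andP: tT => _ tT.
  move=> /andP[/ltW s0 /ltW st]; apply: small.
  by rewrite s0 (le_trans st).
move=> /andP[s0 sT]; rewrite ltNge; apply/negP => eta_us.
pose B := [set t | 0 <= t <= T /\ eta <= u t].
have Bs : B s by split; rewrite ?s0.
have B0 : lbound B 0 by move=> t [/andP[]].
have infB : has_inf B by split; [exists s | exists 0].
have m0 : 0 <= inf B by apply: lb_le_inf => //; exists s.
have mle t : B t -> inf B <= t by move=> Bt; apply: ge_inf => //; exists 0.
have mT : 0 <= inf B <= T by rewrite m0 (le_trans (mle _ Bs)).
have um : u (inf B) < eta.
  apply: le_lt_trans u0eta; apply: until => // t /andP[t0 tm].
  rewrite ltNge; apply/negP => eta_ut.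
  have /mle : B t.
    by split=> //; rewrite (ltW t0) (le_trans (ltW tm))//; case/andP: mT.
  by rewrite leNgt tm.
have cu : {for inf B, continuous u}.
  by apply/differentiable_continuous/derivable1_diffP; case: (udu _ mT).
have /nbhs_ballP[e /= e0 ue] : \forall t \near inf B, u t < eta.
  exact: (cvgr_lt _ cu).
have [t Bt tm] := inf_adherent e0 infB.
have /ue : ball (inf B) e t.
  by rewrite /ball/= distrC ger0_norm ?subr_ge0 ?mle// ltrBlDl.
by rewrite ltNge; case: Bt => _ ->.
Qed.

(** * The linearization estimate *)

Lemma is_derive_mxP (R : realFieldType) (V : normedModType R) m n
    (y : V -> 'M[R]_(m, n)) (x v : V) (dy : 'M[R]_(m, n)) :
  is_derive x v y dy <->
  forall i j, is_derive x v (fun s => y s i j) (dy i j).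
Proof.
split=> [[yv <-] i j|ydy].
  rewrite derive_mx// mxE; apply: derivableP.
  by move/derivable_mxP : yv; exact.
have yv : derivable y x v by apply/derivable_mxP => i j; case: (ydy i j).
apply: DeriveDef => //; rewrite derive_mx//.
by apply/matrixP => i j; rewrite mxE; case: (ydy i j).
Qed.

(** The norm of ['cV[R]_n] is the maximum norm; the Euclidean one can be
    differentiated along a trajectory. *)
Definition sqnorm {R : realType} {n} (x : 'cV[R]_n) : R := \sum_i x i 0 ^+ 2.

Section SqNorm.
Context {R : realType} {n : nat}.
Implicit Types x y : 'cV[R]_n.

Lemma sqnorm_ge0 x : 0 <= sqnorm x.
Proof. by apply: sumr_ge0 => i _; exact: sqr_ge0. Qed.

Lemma sqnorm0 : sqnorm (0 : 'cV[R]_n) = 0.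
Proof. by rewrite /sqnorm big1// => i _; rewrite mxE expr0n. Qed.

Lemma sqnorm_eq0 x : sqnorm x <= 0 -> x = 0.
Proof.
move=> x0; have /eqP : sqnorm x = 0 by apply/eqP; rewrite eq_le x0 sqnorm_ge0.
rewrite psumr_eq0 => [/allP xi|i _]; last exact: sqr_ge0.
apply/matrixP => i j; rewrite ord1 mxE; apply/eqP.
by have := xi i; rewrite mem_index_enum sqrf_eq0; exact.
Qed.

Lemma sqnormZ (s : R) x : sqnorm (s *: x) = s ^+ 2 * sqnorm x.
Proof.
by rewrite /sqnorm big_distrr/=; apply: eq_bigr => i _; rewrite mxE exprMn.
Qed.

Lemma norm_le_sqrt_sqnorm x : `|x| <= Num.sqrt (sqnorm x).
Proof.
rewrite [leLHS]/Num.Def.normr/= mx_normrE; apply: bigmax_le => [|[i j] _ /=].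
  exact: sqrtr_ge0.
rewrite ord1 -sqrtr_sqr ler_wsqrtr// /sqnorm (bigD1 i)//= lerDl.
by apply: sumr_ge0 => k _; exact: sqr_ge0.
Qed.

Lemma sqnorm_le_norm x : sqnorm x <= n%:R * `|x| ^+ 2.
Proof.
apply: (@le_trans _ _ (\sum_(i < n) `|x| ^+ 2)); last first.
  by rewrite sumr_const card_ord mulr_natl.
apply: ler_sum => i _; rewrite -real_normK ?num_real// lerXn2r ?nnegrE//.
by rewrite [leRHS]/Num.Def.normr/= mx_normrE; exact: (le_bigmax _ _ (i, 0)).
Qed.

Lemma is_derive_sqnorm (V : normedModType R) (y : V -> 'cV[R]_n) t v dy :
  is_derive t v y dy ->
  is_derive t v (sqnorm \o y) (2 * \sum_i y t i 0 * dy i 0).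
Proof.
move/is_derive_mxP => ydy.
have -> : sqnorm \o y = \sum_i (fun s => y s i 0) ^+ 2.
  apply/funext => s /=; rewrite fct_sumE.
  by apply: eq_bigr => i _; rewrite fctE.
apply: is_derive_eq => /=; rewrite big_distrr/=.
by apply: eq_bigr => i _; rewrite /GRing.scale/= expr1 mulrA.
Qed.

(** The left-hand side is the derivative of [sqnorm] along a curve with
    velocity [A *m x + h]; the inequality puts it into the form that Gronwall's
    inequality requires. *)
Lemma energy_bound (A : 'M[R]_n) :
  exists2 K : R, 0 <= K & forall x h : 'cV[R]_n,
    2 * (\sum_i x i 0 * (A *m x + h) i 0) <= K * sqnorm x + sqnorm h.
Proof.
pose k : R := \sum_i \sum_j `|A i j|.
have k0 : 0 <= k by apply: sumr_ge0 => i _; exact: sumr_ge0.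
exists (2 * k + 1) => [|x h]; first by rewrite addr_ge0// mulr_ge0.
have quad : \sum_i x i 0 * (A *m x) i 0 <= k * sqnorm x.
  rewrite big_distrl/=; apply: ler_sum => i _.
  rewrite mxE big_distrl big_distrr/=; apply: ler_sum => j _.
  have xle l : x l 0 ^+ 2 <= sqnorm x.
    rewrite /sqnorm (bigD1 l)//= lerDl.
    by apply: sumr_ge0 => m _; exact: sqr_ge0.
  apply: (le_trans (ler_norm _)).
  rewrite mulrCA normrM ler_wpM2l// normrM.
  have := xle i; have := xle j.
  rewrite -(real_normK (num_real (x i 0))) -(real_normK (num_real (x j 0))).
  by have := sqr_ge0 (`|x i 0| - `|x j 0|); nra.
have cross : 2 * (\sum_i x i 0 * h i 0) <= sqnorm x + sqnorm h.
  rewrite /sqnorm -big_split big_distrr/=; apply: ler_sum => i _.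
  by have := sqr_ge0 (x i 0 - h i 0); nra.
under eq_bigr do rewrite mxE mulrDr.
rewrite big_split/=; move: quad cross; lra.
Qed.

Lemma quadratic_sqnorm (g : 'cV[R]_n -> 'cV[R]_n) :
  g =O_ (0 : 'cV[R]_n) (fun x : 'cV[R]_n => `|x| ^+ 2) ->
  exists c r : R, [/\ 0 <= c, 0 < r &
    forall x, sqnorm x < r -> sqnorm (g x) <= c * sqnorm x ^+ 2].
Proof.
move=> /eqO_exP[k k0] /nbhs_ballP[e /= e0 ge].
exists (n%:R * k ^+ 2), (e ^+ 2); split.
- by rewrite mulr_ge0// sqr_ge0.
- by rewrite exprn_gt0.
move=> x xe; apply: (le_trans (sqnorm_le_norm _)).
rewrite -mulrA; apply: ler_wpM2l => //; rewrite -exprMn lerXn2r ?nnegrE//.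
  by rewrite mulr_ge0// ?sqnorm_ge0// ltW.
have xx := norm_le_sqrt_sqnorm x.
have /ge : ball (0 : 'cV[R]_n) e x.
  rewrite -ball_normE/= sub0r normrN; apply: le_lt_trans xx _.
  by rewrite -(ger0_norm (ltW e0)) -sqrtr_sqr ltr_sqrt ?exprn_gt0.
move=> /le_trans; apply; apply: ler_wpM2l; first exact: ltW.
rewrite ger0_norm ?sqr_ge0// -[leRHS]sqr_sqrtr ?sqnorm_ge0//.
by rewrite lerXn2r ?nnegrE ?sqrtr_ge0.
Qed.

End SqNorm.

(** A trajectory [x] that starts close to the equilibrium stays of the order of
    its initial value, by the local Gronwall inequality. The difference
    [x - xi] then solves the linear equation with the forcing term [g (x t)],
    which is quadratic in [x 0], and Gronwall's inequality applies again.
    The constants are uniform in [x] and [xi]: the estimate is applied to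
    families of trajectories that shrink to the equilibrium. *)
Lemma linearization_estimate (R : realType) n (A : 'M[R]_n)
    (g : 'cV[R]_n -> 'cV[R]_n) (T : R) :
  g =O_ (0 : 'cV[R]_n) (fun x : 'cV[R]_n => `|x| ^+ 2) -> 0 <= T ->
  exists C eta : R, [/\ 0 <= C, 0 < eta & forall (x xi : R -> 'cV[R]_n),
    (forall t, 0 <= t <= T -> is_derive t (1 : R) x (A *m x t + g (x t))) ->
    (forall t, 0 <= t <= T -> is_derive t (1 : R) xi (A *m xi t)) ->
    sqnorm (x 0) < eta ->
    forall t, 0 <= t <= T -> sqnorm (x t - xi t) <=
      C * (sqnorm (x 0 - xi 0) + sqnorm (x 0) ^+ 2)].
Proof.
move=> /quadratic_sqnorm[c [r [c0 r0 gc]]] T0.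
have [K K0 AK] := energy_bound A.
pose a := K + c * r; have a0 : 0 <= a by rewrite addr_ge0// mulr_ge0// ltW.
(* [e] bounds the growth of [sqnorm (x t)] on [0, T], as long as
   [sqnorm (x t) < r]; the choice [eta = r / e] guarantees this. *)
pose e := expR (a * T); have e_gt0 : 0 < e by exact: expR_gt0.
pose C := expR (K * T) * (1 + c * e ^+ 2 * T).
have ce0 : 0 <= c * e ^+ 2 by rewrite mulr_ge0// sqr_ge0.
exists C, (r / e); split.
- by rewrite mulr_ge0 ?expR_ge0// addr_ge0// mulr_ge0.
- by rewrite divr_gt0.
move=> x xi xf xiA; rewrite ltr_pdivlMr// mulrC => x0r.
have xbound s : 0 <= s <= T -> sqnorm (x s) <= e * sqnorm (x 0).
  pose du s := 2 * \sum_i x s i 0 * (A *m x s + g (x s)) i 0.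
  apply: (@gronwall_local _ (sqnorm \o x) du a r T a0) => //.
  - by move=> ? /xf /is_derive_sqnorm; exact.
  - by move=> ? _; exact: sqnorm_ge0.
  - move=> {}s sT /= xr; apply: (le_trans (AK _ _)); rewrite /a mulrDl lerD2l.
    apply: (le_trans (gc _ xr)); rewrite -mulrA ler_wpM2l// expr2.
    by rewrite ler_wpM2r ?sqnorm_ge0// ltW.
pose b := c * e ^+ 2 * sqnorm (x 0) ^+ 2.
have b0 : 0 <= b by rewrite mulr_ge0// sqr_ge0.
move=> t tT; pose y := x - xi.
have yf s : 0 <= s <= T -> is_derive s (1 : R) y (A *m y s + g (x s)).
  move=> sT; have xs := xf _ sT; have xis := xiA _ sT.
  apply: is_derive_eq; rewrite /y !fctE mulmxDr mulmxN.
  by rewrite addrAC.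
have gs s : 0 <= s <= T -> sqnorm (g (x s)) <= b.
  move=> sT; have xs := xbound _ sT.
  apply: (le_trans (gc _ (le_lt_trans xs x0r))).
  rewrite /b -mulrA -exprMn ler_wpM2l// lerXn2r ?nnegrE ?sqnorm_ge0//.
  by rewrite mulr_ge0 ?sqnorm_ge0// ltW.
have : sqnorm (y t) <= expR (K * t) * (sqnorm (y 0) + b * t).
  pose du s := 2 * \sum_i y s i 0 * (A *m y s + g (x s)) i 0.
  apply: (@gronwall _ (sqnorm \o y) du K b T K0 b0) => //.
  - by move=> ? /yf /is_derive_sqnorm; exact.
  - move=> s /andP[s0 sT]; apply: (le_trans (AK _ _)).
    by rewrite lerD2l gs// (ltW s0) ltW.
rewrite /y !fctE => /le_trans; apply; case/andP: tT => t0 tT.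
rewrite /C -mulrA; apply: ler_pM; rewrite ?expR_ge0//.
- by rewrite addr_ge0 ?sqnorm_ge0// mulr_ge0.
- by rewrite ler_expR ler_wpM2l.
have bT : b * t <= b * T by rewrite ler_wpM2l.
apply: le_trans (lerD (lexx _) bT) _; rewrite /b.
have := sqnorm_ge0 (x 0 - xi 0); have := sqr_ge0 (sqnorm (x 0)).
have : 0 <= c * e ^+ 2 * T by rewrite mulr_ge0.
set u := sqnorm (x 0) ^+ 2; set v := sqnorm (x 0 - xi 0); set w := c * e ^+ 2.
move=> wT u0 v0; have := mulr_ge0 wT v0; move: u0; lra.
Qed.

(** * Derivative of the flow at the equilibrium *)

Lemma is_derive_quotient (R : realType) (V : normedModType R) (y : R -> V) v :
  y 0 = 0 ->
  is_derive (0 : R) (1 : R) y v <-> h^-1 *: y h @[h --> (0 : R)^'] --> v.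
Proof.
move=> y0.
have -> : (fun h : R => h^-1 *: y h) =
    (fun h : R => h^-1 *: ((y \o shift 0) (h *: 1) - y 0)).
  by apply/funext => h /=; rewrite y0 subr0 addr0 [h *: _]mulr1.
split=> [[yv <-]//|yv].
by apply: DeriveDef; [apply/cvg_ex; exists v|exact/cvg_lim].
Qed.

(** The derivative of the flow at the equilibrium is the flow of the
    linearized equation. It is computed along a curve [c] of initial values, by
    comparing the trajectory of [c s] with the solution [s *: xi] of the
    linear equation: the initial values differ by [o(s)] and the nonlinear term
    contributes [O(s ^+ 2)], so that the trajectories at time [t] differ
    by [o(s)]. *)
Lemma is_derive_flow (R : realType) n (A : 'M[R]_n) (g : 'cV[R]_n -> 'cV[R]_n)
    (T : R) (F : R -> 'cV[R]_n -> 'cV[R]_n) (xi c : R -> 'cV[R]_n) :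
  g =O_ (0 : 'cV[R]_n) (fun x : 'cV[R]_n => `|x| ^+ 2) ->
  is_flow_upto (fun x => A *m x + g x) T F ->
  (forall t, is_derive t (1 : R) xi (A *m xi t)) ->
  c 0 = 0 -> is_derive (0 : R) (1 : R) c (xi 0) ->
  forall t, 0 <= t <= T ->
  F t 0 = 0 /\ is_derive (0 : R) (1 : R) (fun s => F t (c s)) (xi t).
Proof.
move=> gO flow xiA c0 cxi t tT.
have T0 : 0 <= T by case/andP : tT => /le_trans; exact.
have [C [eta [C0 eta0 est]]] := linearization_estimate A gO T0.
have F0 x : F 0 x = x by have [] := flow x.
have Fx x s : 0 <= s <= T ->
    is_derive s (1 : R) (F ^~ x) (A *m F s x + g (F s x)).
  by move=> sT; have [_ [J /(_ s) TJ [_ _ _]]] := flow x; apply; exact: TJ.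
have xisA (s r : R) : is_derive r (1 : R) (s \*: xi) (A *m (s *: xi r)).
  by rewrite -scalemxAr; exact: is_deriveZ.
have estF s x : sqnorm x < eta -> sqnorm (F t x - s *: xi t) <=
    C * (sqnorm (x - s *: xi 0) + sqnorm x ^+ 2).
  move=> xeta; have := est (F ^~ x) (s \*: xi) (Fx x) (fun r _ => xisA s r).
  by rewrite F0; apply.
(* The estimate with [x 0 = 0] and [xi = 0] says that the origin is fixed. *)
have Ft0 : F t 0 = 0.
  apply: sqnorm_eq0; have := estF 0 0; rewrite sqnorm0 !scale0r !subr0 sqnorm0.
  by rewrite expr0n addr0 mulr0; exact.
split=> //; apply/is_derive_quotient; first by rewrite c0.
pose q h := h^-1 *: c h.
have qxi : q h @[h --> (0 : R)^'] --> xi 0 by exact/is_derive_quotient.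
have sq (f : R -> R) (l : R) : f h @[h --> (0 : R)^'] --> l ->
    f h ^+ 2 @[h --> (0 : R)^'] --> l ^+ 2.
  by move=> fl; rewrite expr2; under eq_fun do rewrite expr2; exact: cvgM.
have hid : h @[h --> (0 : R)^'] --> (0 : R) by exact: nbhs_dnbhs.
pose sq_q h := n%:R * `|q h| ^+ 2.
have sq_qxi : sq_q h @[h --> (0 : R)^'] --> n%:R * `|xi 0| ^+ 2.
  by apply: cvgM; [exact: cvg_cst|apply: sq; exact: cvg_norm].
have c_small : \forall h \near (0 : R)^', sqnorm (c h) < eta.
  have h2q : h ^+ 2 * sq_q h @[h --> (0 : R)^'] --> (0 : R).
    rewrite [X in _ --> X](_ : 0 = 0 ^+ 2 * (n%:R * `|xi 0| ^+ 2)); last first.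
      by rewrite expr0n mul0r.
    by apply: cvgM => //; exact: sq.
  near=> h; have h0 : h != 0 by near: h; exact: nbhs_dnbhs_neq.
  apply: (@le_lt_trans _ _ (h ^+ 2 * sq_q h)).
    rewrite -{1}(scalerKV h0 (c h)) sqnormZ.
    by rewrite ler_wpM2l ?sqr_ge0// sqnorm_le_norm.
  by near: h; exact: (cvgr_lt _ h2q).
(* [w h] bounds the square of the distance from the quotient of [F t (c h)] by
   [h] to [xi t]. *)
pose w h := C * (n%:R * `|q h - xi 0| ^+ 2 + h ^+ 2 * sq_q h ^+ 2).
have w0 : w h @[h --> (0 : R)^'] --> (0 : R).
  rewrite [X in _ --> X](_ : 0 = C * (n%:R * `|xi 0 - xi 0| ^+ 2
    + 0 ^+ 2 * (n%:R * `|xi 0| ^+ 2) ^+ 2)); last first.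
    by rewrite subrr normr0 !expr0n/= mulr0 mul0r addr0 mulr0.
  apply: cvgM; first exact: cvg_cst.
  apply: cvgD; last by apply: cvgM; exact: sq.
  apply: cvgM; first exact: cvg_cst.
  by apply: sq; apply: cvg_norm; apply: cvgB => //; exact: cvg_cst.
apply/cvgrPdist_le => /= e e0; near=> h.
have h0 : h != 0 by near: h; exact: nbhs_dnbhs_neq.
rewrite distrC; apply: le_trans (norm_le_sqrt_sqnorm _) _.
rewrite -(ger0_norm (ltW e0)) -sqrtr_sqr ler_wsqrtr//.
apply: (@le_trans _ _ (w h)); last first.
  by apply: ltW; near: h; apply: (cvgr_lt _ w0); rewrite exprn_gt0.
have -> : h^-1 *: F t (c h) - xi t = h^-1 *: (F t (c h) - h *: xi t).
  by rewrite scalerBr scalerK.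
have hc : c h = h *: q h by rewrite /q scalerKV.
have hV : h ^- 2 * h ^+ 2 = 1 by rewrite mulVf// expf_neq0.
rewrite sqnormZ exprVn.
have {}estF : sqnorm (F t (c h) - h *: xi t) <=
    h ^+ 2 * (C * (sqnorm (q h - xi 0) + h ^+ 2 * sqnorm (q h) ^+ 2)).
  apply: le_trans (estF h _ _) _; first by near: h.
  rewrite mulrCA ler_wpM2l// hc -scalerBr !sqnormZ; lra.
apply: (@le_trans _ _ (h ^- 2 * (h ^+ 2 *
    (C * (sqnorm (q h - xi 0) + h ^+ 2 * sqnorm (q h) ^+ 2))))).
  by rewrite ler_wpM2l// invr_ge0 sqr_ge0.
rewrite [leLHS]mulrA hV mul1r ler_wpM2l// lerD ?sqnorm_le_norm//.
rewrite ler_wpM2l ?sqr_ge0//.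
rewrite lerXn2r ?nnegrE ?sqnorm_ge0 ?sqnorm_le_norm//.
by rewrite /sq_q mulr_ge0// sqr_ge0.
Unshelve. all: by end_near. Qed.

(** * Tangent spaces and diffeomorphisms *)

Lemma is_derive_diff_comp (R : realType) (V W : normedModType R)
    (f : V -> W) (c : R -> V) (t : R) dc :
  differentiable f (c t) -> is_derive t (1 : R) c dc ->
  is_derive t (1 : R) (f \o c) ('d f (c t) dc).
Proof.
move=> df [/derivable1_diffP ct <-].
have dfc : differentiable (f \o c) t by exact: differentiable_comp.
apply: DeriveDef; first exact/derivable1_diffP.
by rewrite deriveE// diff_comp//= deriveE.
Qed.

Section TangentSpace.
Context {R : realType}.

Lemma tangent_space_map m n (X : set 'cV[R]_m) (Y : set 'cV[R]_n) f f' U x v :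
  (forall y, X y -> Y (f y)) -> open U -> U x -> Ck 1 U f' ->
  (forall y, X y -> U y -> f' y = f y) -> X x ->
  tangent_space X x v -> tangent_space Y (f x) ('d f' x v).
Proof.
move=> XY oU Ux [df' _] f'E Xx [c [c0 cX cv]].
have Uc : \forall t \near (0 : R), U (c t).
  have cc : {for 0, continuous c}.
    by apply/differentiable_continuous/derivable1_diffP; case: cv.
  have /cc : nbhs (c 0) U by rewrite c0; apply: open_nbhs_nbhs; split.
  exact.
exists (f' \o c); split.
- by rewrite /= c0 f'E.
- near=> t; have [Xct dct] : X (c t) /\ derivable c t 1 by near: t.
  have Uct : U (c t) by near: t.
  split; first by rewrite /= f'E//; exact: XY.
  apply/derivable1_diffP/differentiable_comp; first exact/derivable1_diffP.
  exact: df'.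
- by rewrite -c0; apply: is_derive_diff_comp => //; rewrite c0; exact: df'.
Unshelve. all: by end_near. Qed.

(** The local extensions of [f] and of its inverse map curves of either set to
    curves of the other, and differentiating [f' (h' (c t)) = c t] at [0] shows
    that every tangent vector [w] of [Y] is the image of ['d h' (f x) w]. *)
Lemma tangent_space_diffeo m n (X : set 'cV[R]_m) (Y : set 'cV[R]_n) f f' U x :
  C1_diffeo X Y f -> open U -> U x -> Ck 1 U f' ->
  (forall y, X y -> U y -> f' y = f y) -> X x ->
  tangent_space Y (f x) = 'd f' x @` tangent_space X x.
Proof.
move=> [[XY _ YX] _ [h [hf C1h]]] oU Ux C1f' f'E Xx.
apply/seteqP; split=> [w Yw|_ [v Xv <-]]; 
  last exact: tangent_space_map XY oU Ux C1f' f'E Xx Xv.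
have Yfx : Y (f x) by exact: XY.
have [U2 [h' [oU2 U2fx C1h' h'E]]] := C1h _ Yfx.
have YhX y : Y y -> X (h y) /\ f (h y) = y by move=> /YX[z Xz <-]; rewrite hf.
have Xw : tangent_space X x ('d h' (f x) w).
  have hX y : Y y -> X (h y) by case/YhX.
  by have := tangent_space_map hX oU2 U2fx C1h' h'E Yfx Yw; rewrite hf.
exists ('d h' (f x) w) => //.
case: Yw => c [c0 cY cw].
have cc : {for 0, continuous c}.
  by apply/differentiable_continuous/derivable1_diffP; case: cw.
have dh' : differentiable h' (c 0).
  by case: C1h' => dh' _; apply: dh'; rewrite c0.
have h'c0 : h' (c 0) = x by rewrite c0 h'E// hf.
have dc' := is_derive_diff_comp dh' cw.
have df' : differentiable f' ((h' \o c) 0).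
  by case: C1f' => + _; apply; rewrite /= h'c0.
have U2c : \forall t \near (0 : R), U2 (c t).
  have /cc : nbhs (c 0) U2 by rewrite c0; apply: open_nbhs_nbhs; split.
  exact.
have cc' : {for 0, continuous (h' \o c)}.
  by apply/differentiable_continuous/derivable1_diffP; case: dc'.
have Uc : \forall t \near (0 : R), U (h' (c t)).
  have /cc' : nbhs ((h' \o c) 0) U.
    by rewrite /= h'c0; apply: open_nbhs_nbhs; split.
  exact.
have f'h'c : \forall t \near (0 : R), (f' \o (h' \o c)) t = c t.
  near=> t; have [Yct _] : Y (c t) /\ derivable c t 1 by near: t.
  have U2ct : U2 (c t) by near: t.
  have Uct : U (h' (c t)) by near: t.
  have [Xhc fhc] := YhX _ Yct.
  by move: Uct; rewrite /= h'E// => Uct; rewrite f'E.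
have := near_eq_is_derive f'h'c (is_derive_diff_comp df' dc').
by rewrite /= h'c0 c0 => -[_ <-]; case: cw.
Unshelve. all: by end_near. Qed.

End TangentSpace.

(** * Complex modes of a real linear equation *)

Section Modes.
Context {R : realType}.

Lemma cexp0 : cexp (0 : R[i]) = 1.
Proof.
rewrite /cexp/= expR0 cos0 sin0; apply/eqP; rewrite eq_complex/=.
by rewrite !mulr0 !mul0r !mul1r subr0 addr0 !eqxx.
Qed.

Lemma is_derive_Re_cexp (lambda w : R[i]) (t : R) :
  is_derive t (1 : R) (fun s : R => complex.Re (cexp (lambda * s%:C) * w))
    (complex.Re (lambda * cexp (lambda * t%:C) * w)).
Proof.
case: lambda w => a b [u v].
pose ex := expR \o (a \*: (id : R -> R)).
pose cs := cos \o (b \*: (id : R -> R)).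
pose sn := sin \o (b \*: (id : R -> R)).
have -> : (fun s : R => complex.Re (cexp ((a +i* b) * s%:C) * (u +i* v))) =
    u \*: (ex * cs) - v \*: (ex * sn).
  apply/funext => s; rewrite !fctE /ex /cs /sn /= /GRing.scale/=; simpc.
  by ring.
have dex : is_derive t (1 : R) ex (expR (a * t) *: (a *: 1)).
  exact: is_derive1_comp.
have dcs : is_derive t (1 : R) cs (- sin (b * t) *: (b *: 1)).
  exact: is_derive1_comp.
have dsn : is_derive t (1 : R) sn (cos (b * t) *: (b *: 1)).
  exact: is_derive1_comp.
apply: is_derive_eq; rewrite /ex /cs /sn /= /GRing.scale/=; simpc.
by ring.
Qed.

Lemma Re_mxE m n (z : 'M[R[i]]_(m, n)) i j : Re_mx z i j = complex.Re (z i j).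
Proof. by rewrite mxE. Qed.

Lemma Re_mxD m n (z w : 'M[R[i]]_(m, n)) : Re_mx (z + w) = Re_mx z + Re_mx w.
Proof. by apply/matrixP => i j; rewrite !mxE raddfD. Qed.

Lemma Re_mx_sum m n (I : finType) (z : I -> 'M[R[i]]_(m, n)) :
  Re_mx (\sum_k z k) = \sum_k Re_mx (z k).
Proof.
apply/matrixP => i j; rewrite mxE !summxE raddf_sum.
by apply: eq_bigr => k _; rewrite mxE.
Qed.

(** It transfers facts on real parts to imaginary parts, in statements that
    are invariant under multiplication by a complex scalar. *)
Lemma Im_mx_Re m n (z : 'M[R[i]]_(m, n)) : Im_mx z = Re_mx ((- 'i%C) *: z).
Proof.
apply/matrixP => i j; rewrite !mxE; case: (z i j) => a b /=.
by rewrite oppr0 mul0r mulN1r opprK add0r.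
Qed.

Lemma Re_Im_mx_inj m n (z w : 'M[R[i]]_(m, n)) :
  Re_mx z = Re_mx w -> Im_mx z = Im_mx w -> z = w.
Proof.
move=> /matrixP reE /matrixP imE; apply/matrixP => i j.
apply/eqP; rewrite eq_complex.
by have := reE i j; have := imE i j; rewrite !mxE => -> ->; rewrite !eqxx.
Qed.

Lemma mulmx_Re m n (A : 'M[R]_(m, n)) (z : 'cV[R[i]]_n) :
  A *m Re_mx z = Re_mx (map_mx (real_complex R) A *m z).
Proof.
apply/matrixP => i j; rewrite !mxE raddf_sum; apply: eq_bigr => k _.
by rewrite !mxE /=; case: (z k j) => a b /=; rewrite mul0r subr0.
Qed.

(** The solutions of [x' = A x] whose initial value is the real part of a
    vector in the complex span of the [e k]. *)
Lemma is_derive_modes n d (A : 'M[R]_n) (lambda : 'I_d -> R[i])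
    (e : 'I_d -> 'cV[R[i]]_n) :
  (forall k, map_mx (real_complex R) A *m e k = lambda k *: e k) ->
  forall t : R, is_derive t (1 : R)
    (fun s : R => Re_mx (\sum_k cexp (lambda k * s%:C) *: e k))
    (A *m Re_mx (\sum_k cexp (lambda k * t%:C) *: e k)).
Proof.
move=> Ae t.
have -> : (fun s : R => Re_mx (\sum_k cexp (lambda k * s%:C) *: e k)) =
    \sum_k (fun s : R => Re_mx (cexp (lambda k * s%:C) *: e k)).
  by apply/funext => s; rewrite Re_mx_sum fct_sumE.
rewrite mulmx_Re mulmx_sumr Re_mx_sum; apply: is_derive_sum => k.
apply/is_derive_mxP => i j.
have -> : (fun s : R => Re_mx (cexp (lambda k * s%:C) *: e k) i j) =
    (fun s : R => complex.Re (cexp (lambda k * s%:C) * e k i j)).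
  by apply/funext => s; rewrite !mxE.
rewrite -scalemxAr Ae scalerA Re_mxE mxE (mulrC (cexp _)).
exact: is_derive_Re_cexp.
Qed.

Lemma Re_diffC n (mu : 'cV[R]_n -> R) x z :
  complex.Re (diffC mu x z) = 'd mu x (Re_mx z).
Proof. by []. Qed.

Lemma diffCD n (mu : 'cV[R]_n -> R) x : {morph diffC mu x : z w / z + w}.
Proof.
move=> z w; apply/eqP; rewrite eq_complex /=.
by rewrite !Im_mx_Re scalerDr !Re_mxD !linearD !eqxx.
Qed.

Lemma diffCZ n (mu : 'cV[R]_n -> R) x (c : R[i]) z :
  diffC mu x (c *: z) = c * diffC mu x z.
Proof.
have reZ : Re_mx (c *: z) = complex.Re c *: Re_mx z - complex.Im c *: Im_mx z.
  by apply/matrixP => i j; rewrite !mxE; case: (c) (z i j) => a b [].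
have imZ : Im_mx (c *: z) = complex.Re c *: Im_mx z + complex.Im c *: Re_mx z.
  by apply/matrixP => i j; rewrite !mxE; case: (c) (z i j) => a b [].
rewrite /diffC reZ imZ linearB linearD !linearZ.
case: c {reZ imZ} => a b; apply/eqP; rewrite eq_complex /= /GRing.scale/=.
by rewrite mulrN !eqxx.
Qed.

Lemma diffC_sum n d (mu : 'cV[R]_n -> R) x (c : 'I_d -> R[i]) e :
  diffC mu x (\sum_k c k *: e k) = \sum_k c k * diffC mu x (e k).
Proof.
have diffC0 : diffC mu x 0 = 0 by rewrite -(scale0r 0) diffCZ mul0r.
rewrite (big_morph _ (diffCD mu x) diffC0).
by apply: eq_bigr => k _; rewrite diffCZ.
Qed.

End Modes.

(** * The delay map *)

(** Delayed observation maps a curve of initial values with velocity [xi 0] to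
    a curve whose [j]-th coordinate has velocity ['d mu 0 (xi (j%:R * tau))],
    since the flow maps the curve to one with velocity [xi (j%:R * tau)].
    The extension [S'] agrees with the delay map along a curve in [M]. *)
Lemma diff_delay_map (R : realType) n p (A : 'M[R]_n)
    (g : 'cV[R]_n -> 'cV[R]_n) (F : R -> 'cV[R]_n -> 'cV[R]_n)
    (M : set 'cV[R]_n) (mu : 'cV[R]_n -> R) (tau : R)
    (S' : 'cV[R]_n -> 'cV[R]_p) (U : set 'cV[R]_n) (xi : R -> 'cV[R]_n) :
  g =O_ (0 : 'cV[R]_n) (fun x : 'cV[R]_n => `|x| ^+ 2) ->
  0 <= tau -> is_flow_upto (fun x => A *m x + g x) (p.-1%:R * tau) F ->
  differentiable mu 0 -> differentiable S' 0 -> open U -> U 0 ->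
  (forall y, M y -> U y -> S' y = delay_map F mu tau p y) ->
  (forall t, is_derive t (1 : R) xi (A *m xi t)) ->
  tangent_space M 0 (xi 0) ->
  'd S' 0 (xi 0) = \col_(j < p) 'd mu 0 (xi (j%:R * tau)).
Proof.
move=> gO tau0 flow dmu dS' oU U0 S'E xiA [c [c0 cM cxi]].
have jT (j : 'I_p) : 0 <= j%:R * tau <= p.-1%:R * tau.
  rewrite mulr_ge0//= ler_wpM2r// ler_nat.
  by case: p j {S' dS' flow S'E} => [[]|p []].
have Sc : is_derive (0 : R) (1 : R) (delay_map F mu tau p \o c)
    (\col_(j < p) 'd mu 0 (xi (j%:R * tau))).
  apply/is_derive_mxP => j i; rewrite mxE.
  have [Fj0 Fjc] := is_derive_flow gO flow xiA c0 cxi (jT j).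
  have -> : (fun s => (delay_map F mu tau p \o c) s j i) =
      mu \o (fun s => F (j%:R * tau) (c s)).
    by apply/funext => s; rewrite /= mxE.
  rewrite -[X in 'd mu X]Fj0 -[X in F _ X]c0.
  by apply: is_derive_diff_comp => //; rewrite c0 Fj0.
have S'c : is_derive (0 : R) (1 : R) (S' \o c) ('d S' 0 (xi 0)).
  by rewrite -[X in 'd S' X]c0; apply: is_derive_diff_comp => //; rewrite c0.
have cc : {for 0, continuous c}.
  by apply/differentiable_continuous/derivable1_diffP; case: cxi.
have Uc : \forall t \near (0 : R), U (c t).
  have /cc : nbhs (c 0) U by rewrite c0; apply: open_nbhs_nbhs; split.
  exact.
have S'cE : \forall t \near (0 : R),
    (S' \o c) t = (delay_map F mu tau p \o c) t.
  near=> t; have [Mct _] : M (c t) /\ derivable c t 1 by near: t.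
  by rewrite /= S'E//; near: t.
have [_ dS'c] := near_eq_is_derive S'cE S'c; have [_ dSc] := Sc.
exact: etrans (esym dS'c) dSc.
Unshelve. all: by end_near. Qed.

(** * The tangent space of the embedded manifold *)

Theorem theorem1 (R : realType) (n d p : nat) (led : (d <= n)%N)
    (l : smoothness)
    (A : 'M[R]_n) (g : 'cV[R]_n -> 'cV[R]_n)
    (class_l : of_class l (fun x : 'cV[R]_n => A *m x + g x))
    (g_quadratic : g =O_ (0 : 'cV[R]_n) (fun x : 'cV[R]_n => `|x| ^+ 2))
    (E : 'M[R[i]]_n) (lambda : 'I_n -> R[i])
    (E_basis : E \in unitmx)
    (E_eigen : forall k : 'I_n,
       map_mx (real_complex R) A *m col k E = lambda k *: col k E)
    (tau : R) (tau_gt0 : 0 < tau)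
    (F : R -> 'cV[R]_n -> 'cV[R]_n)
    (F_flow : is_flow_upto (fun x : 'cV[R]_n => A *m x + g x)
                (p.-1%:R * tau) F)
    (M : set 'cV[R]_n)
    (M_manifold : submanifold d M)
    (M_invariant : flow_invariant (fun x : 'cV[R]_n => A *m x + g x) M)
    (M_0 : M 0)
    (M_tangent : complexification (tangent_space M 0) =
       complex_span (fun k : 'I_d => col (widen_ord led k) E))
    (mu : 'cV[R]_n -> R)
    (mu_diff : forall x, differentiable mu x)
    (S_embedding : embedding_on M (delay_map F mu tau p))
    (mu_generic : forall k : 'I_d,
       modal_derivative E mu (widen_ord led k) != 0)
    (lambda_distinct : injective (fun k : 'I_d => lambda (widen_ord led k))) :
  complexification
    (tangent_space (delay_map F mu tau p @` M) (delay_map F mu tau p 0)) =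
  range (fun c : 'cV[R[i]]_d =>
    delay_vandermonde (fun k : 'I_d => lambda (widen_ord led k)) tau p *m c).
Proof.
have [_ /(_ 0 M_0)[U [S' [oU U0 C1S' S'E]]] _] := S_embedding.
have dS' : differentiable S' 0 by case: C1S' => dS' _; exact: dS'.
rewrite (tangent_space_diffeo S_embedding oU U0 C1S' S'E M_0).
pose e k := col (widen_ord led k) E; pose lam k := lambda (widen_ord led k).
pose m k := modal_derivative E mu (widen_ord led k).
(* [V *m mc c] is the image of [w c] under the complexified differential of the
   delay map. *)
pose w (c : 'I_d -> R[i]) := \sum_(k < d) c k *: e k.
pose V := delay_vandermonde lam tau p.
pose mc (c : 'I_d -> R[i]) : 'cV[R[i]]_d := \col_k (c k * m k).
have iw c : (- 'i%C) *: w c = w (fun k => - 'i%C * c k).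
  by rewrite scaler_sumr; apply: eq_bigr => k _; rewrite scalerA.
have imc c : (- 'i%C) *: mc c = mc (fun k => - 'i%C * c k).
  by apply/matrixP => k j; rewrite !mxE mulrA.
have wT c : tangent_space M 0 (Re_mx (w c)) /\ tangent_space M 0 (Im_mx (w c)).
  by have : complex_span e (w c) by [exists c]; rewrite -M_tangent.
have dRe c : 'd S' 0 (Re_mx (w c)) = Re_mx (V *m mc c).
  pose xi t := Re_mx (\sum_k cexp (lam k * t%:C) *: (c k *: e k)).
  have xi0 : xi 0 = Re_mx (w c).
    by congr Re_mx; apply: eq_bigr => k _; rewrite mulr0 cexp0 scale1r.
  have xiA t : is_derive t (1 : R) xi (A *m xi t).
    apply: is_derive_modes => k.
    by rewrite -scalemxAr E_eigen scalerA mulrC -scalerA.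
  have xiT : tangent_space M 0 (xi 0) by rewrite xi0; have [] := wT c.
  have := diff_delay_map g_quadratic (ltW tau_gt0) F_flow (mu_diff 0) dS' oU U0
    S'E xiA xiT.
  rewrite xi0 => ->; apply/matrixP => j i; rewrite [LHS]mxE -Re_diffC [RHS]mxE.
  congr complex.Re; rewrite [RHS]mxE.
  under eq_bigr do rewrite scalerA.
  rewrite diffC_sum; apply: eq_bigr => k _; rewrite !mxE mulrA.
  congr (cexp _ * _ * _).
  by rewrite rmorphM/= rmorph_nat mulrCA mulrA.
(* [w] and [mc] are C-linear, and [Im z = Re (- i z)]. *)
have dIm c : 'd S' 0 (Im_mx (w c)) = Im_mx (V *m mc c).
  by rewrite !Im_mx_Re iw dRe scalemxAr imc.
apply/seteqP; split=> [z [[a Ta az] [b Tb bz]]|_ [c _ <-]].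
  pose v : 'cV[R[i]]_n := \matrix_(i, j) (a i j +i* b i j).
  have va : Re_mx v = a by apply/matrixP => i j; rewrite !mxE.
  have vb : Im_mx v = b by apply/matrixP => i j; rewrite !mxE.
  have : complexification (tangent_space M 0) v by split; rewrite ?va ?vb.
  rewrite M_tangent => -[c vw].
  have {}vw : v = w c by [].
  exists (mc c) => //; apply: Re_Im_mx_inj.
    by rewrite -dRe -vw va.
  by rewrite -dIm -vw vb.
(* Genericity of the observable: the diagonal rescaling [mc] is onto. *)
pose c' k := c k 0 / m k.
have -> : c = mc c'.
  by apply/matrixP => k j; rewrite ord1 mxE divfK//; exact: mu_generic.
split.
  exists (Re_mx (w c')).
    by have [] := wT c'.
  by rewrite dRe.
exists (Im_mx (w c')).
  by have [] := wT c'.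
by rewrite dIm.
Qed.
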